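(* Let $\Delta$ be a finite abstract simplicial complex of dimension $d\ge 1$, and for $k\ge 0$ let $\Delta^{(k)}$ denote its $k$-fold iterated barycentric subdivision. For each $k$, the $h$-polynomial $h^{\Delta^{(k)}}(z)$ is monic of degree $d+1$; label its $d+1$ complex zeros (with multiplicity) as $\rho^{(k)}_\infty,\rho^{(k)}_0,\rho^{(k)}_1,\dots,\rho^{(k)}_{d-1}$, where $\rho^{(k)}_\infty$ has maximal modulus and $\rho^{(k)}_0$ has minimal modulus among them. Then, as $k\to\infty$: (1) $\rho^{(k)}_0\to 0$, and the zeros $\rho^{(k)}_1,\dots,\rho^{(k)}_{d-1}$ can be labelled so that each converges; (2) for all sufficiently large $k$, $\rho^{(k)}_\infty$ is real, and $|\rho^{(k)}_\infty|\to\infty$; (3) the polynomials $H_{1,d}\prod_{i=0}^{d-1}\bigl(z-\rho^{(k)}_i\bigr)$ converge (coefficientwise) to the $H$-polynomial $H_d(z)$; (4) $\prod_{i=1}^{d-1}\rho^{(k)}_i\to(-1)^{d-1}$.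
   Context: An abstract simplicial complex $\Delta$ on a finite set is a family of subsets closed under taking subsets (the empty set included); a $d$-simplex is a member of cardinality $d+1$, and $\dim\Delta$ is the largest such $d$. Let $f^\Delta_i$ be the number of $i$-simplices ($f^\Delta_{-1}=1$). The $h$-polynomial of $\Delta$ (of dimension $d$) is $h^\Delta(z)=\sum_{i=-1}^{d}f^\Delta_i(z-1)^{d-i}$. The barycentric subdivision $\Delta'$ of $\Delta$ is the complex consisting of $\emptyset$ together with all sets $\{\sigma_0,\dots,\sigma_n\}$ ($n\ge0$) of nonempty simplices of $\Delta$ with $\sigma_0\subsetneq\sigma_1\subsetneq\cdots\subsetneq\sigma_n$; $\Delta^{(0)}=\Delta$, $\Delta^{(k+1)}=(\Delta^{(k)})'$. For integers $i,d\ge -1$ define $f_{-1,-1}=1$, $f_{-1,d}=0$ for $d\ge0$, $f_{i,-1}=0$ for $i\ge0$, and $f_{i,d}=(i+1)!\,S(d+1,i+1)$ for $i,d\ge0$, where $S(\cdot,\cdot)$ is the Stirling number of the second kind (so $f_{i,d}=0$ for $i>d$). For $d\ge0$ define rational numbers $F_{i,d}$, $-1\le i\le d$, by $F_{d,d}=1$ and, recursively downward for $-1\le i\le d-1$, $F_{i,d}=\frac{1}{(d+1)!-(i+1)!}\sum_{j=i+1}^{d}f_{i,j}F_{j,d}$ (so $F_{-1,d}=0$). Let $F_d(z)=\sum_{i=-1}^dF_{i,d}z^{d-i}$, and define the $H$-polynomial $H_d(z)=F_d(z-1)=\sum_{i=0}^{d+1}H_{i,d}z^{d+1-i}$, which defines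 the numbers $H_{i,d}$. *)

(* Defs.v *)
From HB Require Import structures.
From Stdlib Require Import Reals.
From mathcomp Require Import ssreflect ssrfun ssrbool eqtype ssrnat seq choice fintype finset bigop binomial.
Set Implicit Arguments. Unset Strict Implicit. Unset Printing Implicit Defensive.

Definition is_complex (T : finType) (D : {set {set T}}) : Prop :=
  set0 \in D /\ forall s t : {set T}, s \in D -> t \subset s -> t \in D.

Definition cdim (T : finType) (D : {set {set T}}) : nat := (\max_(s in D) #|s|).-1.

Definition fcount (T : finType) (D : {set {set T}}) (j : nat) : nat :=
  #|[set s in D | #|s| == j]|.

(* a set of sets totally ordered by inclusion (a nonempty such finite set is
   exactly a strict chain s_0 ⊊ s_1 ⊊ ... ⊊ s_n) *)
Definition is_chain (T : finType) (S : {set {set T}}) : bool :=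
  [forall s in S, forall t in S, (s \subset t) || (t \subset s)].

Definition bsd (T : finType) (D : {set {set T}}) : {set {set {set T}}} :=
  [set S : {set {set T}} | (S == set0) || ((S \subset D :\ set0) && is_chain S)].

Fixpoint iterT (T : finType) (k : nat) : finType :=
  match k with 0 => T | k'.+1 => {set iterT T k'} end.

Fixpoint bsd_iter (T : finType) (D : {set {set T}}) (k : nat)
  : {set {set iterT T k}} :=
  match k return {set {set iterT T k}} with
  | 0 => D
  | k'.+1 => bsd (bsd_iter D k')
  end.

Definition Cx := (R * R)%type.
Definition RtoC (x : R) : Cx := (x, 0%R).
Definition Cadd (z w : Cx) : Cx := (fst z + fst w, snd z + snd w)%R.
Definition Csub (z w : Cx) : Cx := (fst z - fst w, snd z - snd w)%R.
Definition Cmul (z w : Cx) : Cx :=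
  (fst z * fst w - snd z * snd w, fst z * snd w + snd z * fst w)%R.
Definition Cnorm (z : Cx) : R := sqrt (fst z * fst z + snd z * snd z)%R.
Fixpoint Cpow (z : Cx) (n : nat) : Cx :=
  match n with 0 => RtoC 1 | n'.+1 => Cmul z (Cpow z n') end.
Fixpoint Csum (f : nat -> Cx) (n : nat) : Cx :=
  match n with 0 => RtoC 0 | n'.+1 => Cadd (Csum f n') (f n') end.
Fixpoint Cprod (f : nat -> Cx) (n : nat) : Cx :=
  match n with 0 => RtoC 1 | n'.+1 => Cmul (Cprod f n') (f n') end.

Definition Ccv (u : nat -> Cx) (L : Cx) : Prop :=
  Un_cv (fun k => Cnorm (Csub (u k) L)) 0%R.

(* h^D(z) = sum_{i=-1}^{dim} f_i (z-1)^{dim-i}; with j = i+1, f_{j-1} = fcount D j *)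
Definition hpoly (T : finType) (D : {set {set T}}) (z : Cx) : Cx :=
  let n := (cdim D).+1 in
  Csum (fun j => Cmul (RtoC (INR (fcount D j))) (Cpow (Csub z (RtoC 1)) (n - j))) n.+1.

(* coefficient of z^m in prod_{i<n} (z - r i) *)
Fixpoint prodcoef (r : nat -> Cx) (n : nat) : nat -> Cx :=
  match n with
  | 0 => fun m => if m == 0 then RtoC 1 else RtoC 0
  | n'.+1 => fun m =>
      Csub (if m is m'.+1 then prodcoef r n' m' else RtoC 0)
           (Cmul (r n') (prodcoef r n' m))
  end.

Fixpoint stirling2 (n k : nat) : nat :=
  match n, k with
  | 0, 0 => 1
  | 0, _.+1 => 0
  | _.+1, 0 => 0
  | n'.+1, k'.+1 => k'.+1 * stirling2 n' k'.+1 + stirling2 n' k'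
  end.

(* fnum (i+1) (d+1) = f_{i,d} for i,d >= -1 (uniform formula (i+1)! S(d+1,i+1),
   which also gives f_{-1,-1}=1, f_{-1,d}=0, f_{i,-1}=0) *)
Definition fnum (a b : nat) : nat := a`! * stirling2 b a.

(* Gf b m t = F_{i,d} with b = d+1 and i+1 = b - t, valid for t <= m:
   downward recursion F_{d,d} = 1,
   F_{i,d} = 1/((d+1)! - (i+1)!) * sum_{j=i+1}^{d} f_{i,j} F_{j,d} *)
Fixpoint Gf (b m : nat) : nat -> R :=
  match m with
  | 0 => fun _ => 1%R
  | m'.+1 => fun t =>
      if t <= m' then Gf b m' t
      else (/ (INR b`! - INR (b - m'.+1)`!) *
            sum_f_R0 (fun t' => INR (fnum (b - m'.+1) (b - t')) * Gf b m' t') m')%R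
  end.

(* Fc d a = F_{a-1,d}  for 0 <= a <= d+1 *)
Definition Fc (d a : nat) : R := Gf d.+1 d.+1 (d.+1 - a).

Definition msign (n : nat) : R := ((-1) ^ n)%R.

(* Hcoef d m = coefficient of z^m in H_d(z) = F_d(z-1)
   = sum_{i=-1}^{d} F_{i,d} (z-1)^{d-i}; so H_{i,d} = Hcoef d (d+1-i). *)
Definition Hcoef (d m : nat) : R :=
  sum_f_R0 (fun a => Fc d a * INR 'C(d.+1 - a, m) * msign (d.+1 - a - m))%R d.+1.

(* Main.v *)
(* Put n = d + 1. Removing the largest face of a chain shows that subdivision acts on the
   numbers f_(a-1) of faces with a elements through the upper triangular matrix
   A_(a,b) = a! S(b,a), whose diagonal is 0!, 1!, ..., n!. Hence f^(k) / n!^k tends to f_d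
   times the n!-eigenvector F of A normalised at the top, and the h-polynomials, rescaled
   by f_d n!^k, tend to H_d, which has degree d = n - 1 because F_(0,d) > 0. One root thus
   escapes to infinity; dividing it out is continuous, which gives (3), and a nonreal
   escaping root would have a conjugate among the remaining, bounded ones.
   A commutes with B_(i,j) = (-1)^(n-j) C(j,i), so BF = F (Dehn-Sommerville). Row 0 says
   H_d(0) = 0, so the smallest root tends to 0, and row 1 says that the coefficients of z
   and z^d in H_d agree, which is (4). Convergence of the individual roots is the continuity
   of the roots of a monic polynomial. *)
Require Import Defs.
From HB Require Import structures.
From Stdlib Require Import Reals.
From mathcomp Require Import all_boot all_order all_algebra.
From mathcomp Require Import zify ring lra.
From mathcomp Require Import complex Rstruct.
Set Implicit Arguments. Unset Strict Implicit. Unset Printing Implicit Defensive.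

(** * Face numbers of barycentric subdivisions *)

(** In a partition of [b + 1] points into [i + 1] blocks, delete the block of a distinguished point;
    [j] counts the points outside it. *)
Lemma sum_bin_stirling2 b i :
  \sum_(j < b.+1) 'C(b, j) * stirling2 j i = stirling2 b.+1 i.+1.
Proof.
elim: b i => [|b IHb] i.
  by rewrite big_ord_recl big_ord0 /= bin0 mul1n addn0; case: i => [|i] //=; rewrite muln0.
rewrite big_ord_recl bin0 mul1n.
have -> : \sum_(j < b.+1) 'C(b.+1, bump 0 j) * stirling2 (bump 0 j) i =
   \sum_(j < b.+1) 'C(b, j.+1) * stirling2 j.+1 i
   + \sum_(j < b.+1) 'C(b, j) * stirling2 j.+1 i.
  by rewrite -big_split; apply: eq_bigr => j _; rewrite /bump add1n binS mulnDl.
rewrite addnA (_ : stirling2 0 i + _ = stirling2 b.+1 i.+1); last first.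
  rewrite -IHb [RHS]big_ord_recl bin0 mul1n big_ord_recr /= bin_small // mul0n addn0.
  by congr (_ + _); apply: eq_bigr.
rewrite [RHS](_ : _ = i.+1 * stirling2 b.+1 i.+1 + stirling2 b.+1 i) //.
rewrite mulSn -addnA; congr (_ + _).
case: i => [|i]; first by rewrite mul0n /= big1 // => j _; rewrite muln0.
rewrite -(IHb i) -(IHb i.+1) big_distrr -big_split; apply: eq_bigr => j _ /=.
by rewrite mulnDr mulnCA.
Qed.

Lemma stirling2_small n k : n < k -> stirling2 n k = 0.
Proof.
elim: n k => [|n IHn] [|k] //= ltnk.
by rewrite !IHn ?muln0 //; lia.
Qed.

Lemma stirling2_nn n : stirling2 n n = 1.
Proof. by elim: n => //= n ->; rewrite stirling2_small // muln0. Qed.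

Lemma stirling2_1 n : stirling2 n.+1 1 = 1.
Proof. by elim: n => // n IHn; rewrite [LHS](_ : _ = 1 * stirling2 n.+1 1 + 0) // IHn. Qed.

Lemma fnum_small a b : b < a -> fnum a b = 0.
Proof. by move=> /stirling2_small E; rewrite /fnum E muln0. Qed.

Lemma fnum_nn a : fnum a a = a`!.
Proof. by rewrite /fnum stirling2_nn muln1. Qed.

(** [fnum a b] counts ordered partitions of [b] points into [a] blocks. One block is removed here,
    and [j < b] because it is nonempty. In the proof, the term [j = b] cancels against
    [stirling2 b a]. *)
Lemma fnumS a b : fnum a.+1 b = \sum_(j < b) 'C(b, j) * fnum a j.
Proof.
have /eqP := sum_bin_stirling2 b a.
rewrite big_ord_recr /= binn mul1n eqn_add2r => /eqP E.
rewrite /fnum factS -mulnA mulnCA -E big_distrr.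
by apply: eq_bigr => j _; rewrite mulnCA.
Qed.

(** * Counting chains of faces *)

Section Chains.
Variable T : finType.
Implicit Types (s t : {set T}) (S : {set {set T}}) (D : {set {set T}}).

(** The union of a nonempty chain is its largest member. Prescribing [cover S] rather than a top
    element also admits the empty chain, for [s = set0] and [a = 0]. *)
Definition top_chains s a : {set {set {set T}}} :=
  [set S : {set {set T}} | [&& is_chain S, set0 \notin S, cover S == s & #|S| == a]].

Lemma is_chainP S :
  reflect {in S &, forall s t, (s \subset t) || (t \subset s)} (is_chain S).
Proof.
apply: (iffP forall_inP) => [H s t sS tS | H s sS].
  exact: (forall_inP (H s sS)).
by apply/forall_inP => t tS; apply: H.
Qed.

Lemma sub_chain S S' : S' \subset S -> is_chain S -> is_chain S'.
Proof.
by move=> /subsetP sSS' /is_chainP H; apply/is_chainP => s t sS tS; apply: H; apply: sSS'.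
Qed.

Lemma cover_chain S : is_chain S -> S != set0 -> cover S \in S.
Proof.
move=> /is_chainP chS /set0Pn [s0 s0S].
case: (arg_maxnP (fun s => #|s|) s0S) => m mS mmax.
suff -> : cover S = m by [].
apply/eqP; rewrite eqEsubset (bigcup_sup m) ?andbT //.
apply/bigcupsP => s sS; case/orP: (chS s m sS mS) => // sms.
by have /eqP-> : m == s by rewrite eqEcard sms; exact: mmax.
Qed.

Lemma cover_D1_chain S : is_chain S -> S != set0 -> cover S != set0 ->
  cover (S :\ cover S) \proper cover S.
Proof.
move=> chS Sn0 cn0.
have [->|S'n0] := eqVneq (S :\ cover S) set0.
  by rewrite /cover big_set0 properE sub0set subset0.
have := cover_chain (sub_chain (subD1set S (cover S)) chS) S'n0.
rewrite in_setD1 => /andP[ne inS]; rewrite properEneq ne /=.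
exact: (bigcup_sup _ inS).
Qed.

(** Removing [s] from a chain with largest member [s] leaves a chain whose union [t] is a proper
    subset of [s]. Sorting by [#|t|] gives the recursion [fnumS]. *)
Lemma card_top_chains s a : #|top_chains s a| = fnum a #|s|.
Proof.
elim: a s => [|a IHa] s.
  rewrite /fnum mul1n; have [->|sn0] := eqVneq s set0.
    rewrite cards0 -[RHS](cards1 (set0 : {set {set T}})); apply: eq_card => S; rewrite !inE cards_eq0.
    apply/and4P/eqP => [[_ _ _ /eqP] //|->]; rewrite inE /cover big_set0 !eqxx; split=> //.
    by apply/is_chainP => ? ?; rewrite inE.
  have [k ->] : exists k, #|s| = k.+1.
    by exists #|s|.-1; rewrite prednK // lt0n cards_eq0.
  apply/eqP; rewrite cards_eq0; apply/eqP/setP => S; rewrite !inE cards_eq0.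
  apply/and4P => [[_ _ /eqP cS /eqP S0]]; move: cS sn0.
  by rewrite S0 /cover big_set0 => <-; rewrite eqxx.
have [->|sn0] := eqVneq s set0.
  rewrite fnumS cards0 big_ord0; apply/eqP; rewrite cards_eq0; apply/eqP/setP => S.
  rewrite !inE; apply/and4P => [[chS nS /eqP cS /eqP aS]].
  by move: nS; rewrite -cS cover_chain // -card_gt0 aS.
rewrite fnumS.
have in_s t S : t \proper s -> S \in top_chains t a -> s \notin S.
  rewrite properEcard inE => /andP[ts lts] /and4P[_ _ /eqP cS _].
  apply/negP => sS; have : s \subset t by rewrite -cS (bigcup_sup s).
  by move/subset_leq_card; rewrite leqNgt lts.
rewrite -sum1_card (partition_big (fun S => cover (S :\ s)) (fun t => t \proper s)) /=; last first.
  move=> S; rewrite inE => /and4P[chS _ /eqP cS /eqP aS].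
  by rewrite -cS cover_D1_chain ?cS // -card_gt0 aS.
(* Deleting and inserting [s] are mutually inverse, thanks to [in_s]. *)
have fibre t : t \proper s ->
    [set S in top_chains s a.+1 | cover (S :\ s) == t] = [set s |: S | S in top_chains t a].
  move=> ts; apply/setP => S; apply/setIdP/imsetP => [[]|[S' S'ch ->]].
    rewrite inE => /and4P[chS nS /eqP cS /eqP aS] /eqP ct.
    have sS : s \in S by rewrite -cS cover_chain // -card_gt0 aS.
    exists (S :\ s); last by rewrite setD1K.
    rewrite inE (sub_chain (subD1set S s)) // ct eqxx in_setD1 negb_and nS orbT /=.
    by move: aS; rewrite (cardsD1 s) sS add1n => -[->].
  have sS' := in_s _ _ ts S'ch.
  move: S'ch; rewrite !inE => /and4P[/is_chainP chS nS /eqP cS /eqP aS].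
  rewrite setU1K // cS eqxx; split=> //.
  have sub u : u \in S' -> u \subset s.
    by move=> uS; apply: subset_trans (proper_sub ts); rewrite -cS (bigcup_sup u).
  apply/and4P; split.
  - apply/is_chainP => u v /setU1P[->|uS] /setU1P[->|vS]; first by rewrite subxx.
    + by rewrite sub ?orbT.
    + by rewrite sub.
    exact: chS.
  - by rewrite negb_or eq_sym sn0.
  - rewrite /cover; apply/eqP/setP => x; apply/bigcupP/idP => [[u /setU1P[->|/sub/subsetP]]//|xs].
      exact.
    by exists s => //; rewrite setU11.
  by rewrite cardsU1 sS' aS.
rewrite (eq_bigr (fun t => fnum a #|t|)); last first.
  move=> t ts; rewrite -(IHa t).
  have <- : #|[set S in top_chains s a.+1 | cover (S :\ s) == t]| = #|top_chains t a|.
    rewrite fibre // card_in_imset // => S1 S2 h1 h2 e.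
    by rewrite -(setU1K (in_s _ _ ts h1)) e (setU1K (in_s _ _ ts h2)).
  by rewrite -sum1_card; apply: eq_bigl => S; rewrite [in RHS]inE.
(* No proper subset of [s] has size [#|s|], so the last index contributes nothing. *)
rewrite (partition_big (fun t => inord #|t| : 'I_#|s|.+1) predT) //=.
rewrite big_ord_recr /= [X in _ + X]big1 ?addn0; last first.
  move=> t /andP[/proper_card ts /eqP/(congr1 val)]; rewrite /= inordK; last by lia.
  by move=> E; rewrite E ltnn in ts.
apply: eq_bigr => j _.
rewrite -(cards_draws s j) -[X in X * _]sum1_card big_distrl /=.
apply: eq_big => [t | t].
  rewrite !inE -val_eqE /= properEcard.
  case: (boolP (t \subset s)) => //= /subset_leq_card ts; rewrite inordK; last by lia.
  by case: (#|t| =P j) => [->|_]; rewrite ?andbF // ltn_ord.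
case/andP => /proper_card ts /eqP/(congr1 val) /=; rewrite inordK; last by lia.
by move=> ->; rewrite mul1n.
Qed.

Lemma bsd_is_complex D : is_complex (bsd D).
Proof.
split=> [|S S']; first by rewrite inE eqxx.
rewrite !inE => /orP[/eqP-> | /andP[SD chS] S'S]; first by rewrite subset0 => ->.
by rewrite (subset_trans S'S SD) (sub_chain S'S chS) orbT.
Qed.

(** The empty chain has union [set0], a face, and needs no separate clause. For any other chain,
    closure under subsets reduces membership to its largest face. *)
Lemma bsd_setE D : is_complex D ->
  bsd D = [set S : {set {set T}} | [&& is_chain S, set0 \notin S & cover S \in D]].
Proof.
move=> [D0 Dsub]; apply/setP => S; rewrite !inE.
have [->|Sn0] /= := eqVneq S set0.
  rewrite /cover big_set0 D0 inE andbT; apply/esym/andP; split=> //.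
  by apply/is_chainP => ? ?; rewrite inE.
rewrite andbC; case: (boolP (is_chain S)) => //= chS.
apply/idP/andP => [/subsetP SD | [nS cD]].
  split; first by apply/negP => /SD; rewrite setD11.
  by have := SD _ (cover_chain chS Sn0); rewrite inE => /andP[].
apply/subsetP => s sS; rewrite !inE.
have -> /= : s != set0 by apply: contraNneq nS => <-.
by apply: (Dsub _ _ cD); apply: bigcup_sup.
Qed.

(** Chains are sorted by their largest face, and these faces by cardinality. *)
Lemma fcount_bsd D n a : is_complex D -> (forall s, s \in D -> #|s| <= n) ->
  fcount (bsd D) a = \sum_(b < n.+1) fnum a b * fcount D b.
Proof.
move=> Dc Dn; rewrite /fcount bsd_setE //.
rewrite -sum1_card (partition_big (@cover T) (mem D)) /=; last first.
  by move=> S; rewrite !inE => /andP[/and3P[]].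
rewrite (eq_bigr (fun s : {set T} => fnum a #|s|)); last first.
  move=> s sD; rewrite -card_top_chains -sum1_card; apply: eq_bigl => S.
  rewrite !inE; case: (cover S =P s) => [->|]; last by rewrite !andbF.
  by rewrite sD !andbT -andbA.
rewrite (partition_big (fun s => inord #|s| : 'I_n.+1) predT) //=.
apply: eq_bigr => j _; rewrite -sum1_card big_distrr /=.
apply: eq_big => [s | s].
  rewrite inE -val_eqE /=; case: (boolP (s \in D)) => //= /Dn sn.
  by rewrite inordK.
by case/andP => /Dn sn /eqP/(congr1 val) /=; rewrite inordK // muln1 => ->.
Qed.

Lemma card_le_max D s : s \in D -> #|s| <= \max_(t in D) #|t|.
Proof. by move=> sD; rewrite (bigmax_sup s). Qed.

Lemma fcount_max_gt0 D : is_complex D -> 0 < fcount D (\max_(s in D) #|s|).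
Proof.
move=> [D0 _]; case: (eq_bigmax_cond (fun s => #|s|) (A := mem D)).
  by apply/card_gt0P; exists set0.
by move=> s sD E; apply/card_gt0P; exists s; rewrite inE sD -E /=.
Qed.

End Chains.

(** Triangularity of [fnum] excludes larger faces; the positive diagonal entry at [n] preserves the
    faces with [n] elements. *)
Lemma max_card_bsd (T : finType) (D : {set {set T}}) : is_complex D ->
  \max_(S in bsd D) #|S| = \max_(s in D) #|s|.
Proof.
move=> Dc; set n := \max_(s in D) _.
have Dn (s : {set T}) : s \in D -> #|s| <= n by exact: card_le_max.
apply/eqP; rewrite eqn_leq; apply/andP; split.
  rewrite leqNgt; apply/negP => lt.
  have := fcount_max_gt0 (bsd_is_complex D).
  rewrite (fcount_bsd _ Dc Dn) big1 // => b _.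
  by rewrite fnum_small // (leq_ltn_trans _ lt) // -ltnS.
have : 0 < fcount (bsd D) n.
  rewrite (fcount_bsd _ Dc Dn) big_ord_recr /= fnum_nn ltn_addl // muln_gt0 fact_gt0.
  exact: fcount_max_gt0.
case/card_gt0P => S; rewrite inE => /andP[SD /eqP <-]; exact: card_le_max.
Qed.

Section Iterate.
Variables (T : finType) (D : {set {set T}}).
Hypothesis Dc : is_complex D.
Let n := \max_(s in D) #|s|.

Lemma bsd_iter_is_complex k : is_complex (bsd_iter D k).
Proof. by case: k => //= k; apply: bsd_is_complex. Qed.

Lemma max_card_bsd_iter k : \max_(s in bsd_iter D k) #|s| = n.
Proof. by elim: k => //= k <-; apply/max_card_bsd/bsd_iter_is_complex. Qed.

Lemma fcount_bsd_iterS k a :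
  fcount (bsd_iter D k.+1) a = \sum_(b < n.+1) fnum a b * fcount (bsd_iter D k) b.
Proof.
apply: fcount_bsd; first exact: bsd_iter_is_complex.
by move=> s; rewrite -(max_card_bsd_iter k); exact: card_le_max.
Qed.
End Iterate.

(** * The top eigenvector of the subdivision matrix *)

Import Order.TTheory GRing.Theory Num.Theory.
Local Open Scope ring_scope.
Local Arguments stirling2 _ _ : simpl never.

(** The last of [b + 1] points goes into one of [a + 1] blocks, which may or may not contain other
    points. *)
Lemma fnumSS a b : fnum a.+1 b.+1 = (a.+1 * (fnum a.+1 b + fnum a b))%N.
Proof.
rewrite /fnum [stirling2 _ _](_ : _ = a.+1 * stirling2 b a.+1 + stirling2 b a)%N //.
by rewrite factS; ring.
Qed.

(** Together with [sum_bin_stirling2], this is the commutation of [fnum] with the signed binomial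
    matrix. The bound [n] is flexible because [fnum a b] vanishes for [a > b]. *)
Lemma sum_sign_bin_fnum (K : comPzRingType) n b i : (b < n)%N ->
  \sum_(a < n) (-1) ^+ a * ('C(a, i) * fnum a b)%:R
    = (-1) ^+ b * (i`! * stirling2 b.+1 i.+1)%:R :> K.
Proof.
elim: b n i => [|b IHb] [|n] i // ltbn.
  rewrite big_ord_recl big1 ?addr0; last by move=> j _; rewrite fnum_small ?muln0 ?mulr0.
  rewrite bin0n; case: i => [|i] //=.
  by rewrite /fnum /stirling2 !(muln0, mulr0).
rewrite big_ord_recl [X in X + _](_ : _ = 0) ?add0r; last by rewrite /fnum /stirling2 !muln0 mulr0.
(* [fnumSS] splits each term; shifting the index in the part with [fnum a.+1 b] adds a term at
   [a = 0], killed by the factor [a]. *)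
have -> : \sum_(a < n) (-1) ^+ bump 0 a * ('C(bump 0 a, i) * fnum (bump 0 a) b.+1)%:R =
   \sum_(a < n.+1) (-1) ^+ a * ('C(a, i) * (a * fnum a b))%:R
   - \sum_(a < n) (-1) ^+ a * ('C(a.+1, i) * (a.+1 * fnum a b))%:R :> K.
  rewrite big_ord_recl mul0n muln0 mulr0 add0r -sumrB; apply: eq_bigr => a _.
  rewrite lift0 /bump add1n fnumSS exprS.
  by move: (fnum a.+1 b) (fnum a b) => x y; rewrite !natrM natrD; ring.
rewrite big_ord_recr /= fnum_small // !muln0 mulr0 addr0 -sumrB.
(* Pascal's rule and absorption reduce the difference to the induction hypothesis at [i] and
   [i - 1]. For [i = 0] the truncated [i.-1] is multiplied by zero. *)
have -> : \sum_(a < n) ((-1) ^+ a * ('C(a, i) * (a * fnum a b))%:R -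
       (-1) ^+ a * ('C(a.+1, i) * (a.+1 * fnum a b))%:R)
   = - (i.+1%:R * \sum_(a < n) (-1) ^+ a * ('C(a, i) * fnum a b)%:R
      + i%:R * \sum_(a < n) (-1) ^+ a * ('C(a, i.-1) * fnum a b)%:R) :> K.
  rewrite !mulr_sumr -big_split -sumrN; apply: eq_bigr => a _ /=.
  have E : ('C(a.+1, i) * a.+1 = 'C(a, i) * a + i.+1 * 'C(a, i) + i * 'C(a, i.-1))%N.
    case: i => [|i]; first by rewrite !bin0; lia.
    rewrite /= binS; have := mul_bin_left a i.
    case: (leqP i a) => [le_ia | lt_ai _]; last by rewrite !bin_small //; lia.
    rewrite mulnBl => E; have := leq_mul2r 'C(a, i) i a; rewrite le_ia orbT => le; nia.
  rewrite !mulnA E; move: (fnum a b) => x; rewrite !natrM !natrD !natrM; ring.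
rewrite !IHb //.
rewrite [stirling2 b.+2 _](_ : _ = i.+1 * stirling2 b.+1 i.+1 + stirling2 b.+1 i)%N //.
rewrite exprS; case: i => [|i].
  have -> : stirling2 b.+1 0 = 0%N by [].
  by rewrite !mul0r fact0 !mul1n !addn0 addr0 mul1r mulN1r mulNr.
rewrite [in RHS]factS /= factS; move: (stirling2 _ _) (stirling2 _ _) i`! => x y z.
by rewrite !natrM natrD !natrM; ring.
Qed.

Lemma sum_fnum_split (K : comPzRingType) n a (H : nat -> K) : (a <= n)%N ->
  \sum_(b < n.+1) (fnum a b)%:R * H b
    = a`!%:R * H a + \sum_(b < n.+1 | (a < b)%N) (fnum a b)%:R * H b.
Proof.
rewrite -ltnS => an; rewrite (bigD1 (Ordinal an)) //= fnum_nn; congr (_ + _).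
rewrite [LHS](bigID (fun b : 'I_n.+1 => (a < b)%N)) /= [X in _ + X]big1 ?addr0.
  by apply: eq_bigl => b; rewrite -val_eqE /=; case: ltngtP.
move=> b /andP[]; rewrite -val_eqE /= => ne le; rewrite fnum_small ?mul0r //.
by rewrite ltn_neqAle ne leqNgt.
Qed.

Section TopEigenvector.
Variable n : nat.
Hypothesis n1 : (1 < n)%N.

(** The assumption [1 < n] rules out the tie [0! = 1!]. *)
Lemma fact_lt a : (a < n)%N -> (a`! < n`!)%N.
Proof.
by case: a => [_|a /ltn_fact]; [rewrite fact0 (leq_trans n1 (fact_geq n)) | apply].
Qed.

(** The last diagonal entry [n!] exceeds all the others, so back-substitution from index [n]
    determines every entry. *)
Lemma eigenvector_unique (F G : nat -> R) :
  (forall a, (a <= n)%N -> n`!%:R * F a = \sum_(b < n.+1) (fnum a b)%:R * F b) ->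
  (forall a, (a <= n)%N -> n`!%:R * G a = \sum_(b < n.+1) (fnum a b)%:R * G b) ->
  F n = G n -> forall a, (a <= n)%N -> F a = G a.
Proof.
move=> eF eG Fn a an; pose t := (n - a)%N; have -> : a = (n - t)%N by rewrite subKn.
elim/ltn_ind: t {an} => t IH.
have [tn|nt] := leqP t n; last first.
  by move: (IH n nt); rewrite subnn; have -> : (n - t = 0)%N by lia.
have [->|t0] := posnP t; first by rewrite subn0.
set a' := (n - t)%N; have a'n : (a' < n)%N by lia.
have /eqP := eF a' (ltnW a'n); have /eqP := eG a' (ltnW a'n).
rewrite !(sum_fnum_split _ (ltnW a'n)) ![a'`!%:R * _ + _]addrC -!subr_eq -!mulrBl => /eqP EG /eqP EF.
have nz : n`!%:R - a'`!%:R != 0 :> R by rewrite subr_eq0 eqr_nat; have := fact_lt a'n; lia.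
apply: (mulfI nz); rewrite EF EG; apply: eq_bigr => b a'b.
have -> : nat_of_ord b = (n - (n - b))%N by have := ltn_ord b; lia.
by rewrite IH //; have := ltn_ord b; lia.
Qed.

(** By commutation, the left-hand side is again an eigenvector for [n!], with the same entry at [n];
    uniqueness identifies it with [F]. *)
Lemma sign_bin_eigenvector (F : nat -> R) :
  (forall a, (a <= n)%N -> n`!%:R * F a = \sum_(b < n.+1) (fnum a b)%:R * F b) ->
  forall i, (i <= n)%N ->
  \sum_(b < n.+1) (-1) ^+ (n + b) * ('C(b, i))%:R * F b = F i.
Proof.
move=> eF; pose G i := \sum_(b < n.+1) (-1) ^+ (n + b) * ('C(b, i))%:R * F b.
apply: (@eigenvector_unique G) => // [i le_in|]; last first.
  rewrite /G big_ord_recr /= binn addnn -signr_odd odd_double mulr1 mul1r big1 ?add0r //.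
  by move=> b _; rewrite bin_small ?mulr0 ?mul0r.
have -> : n`!%:R * G i =
   \sum_(b < n.+1) (\sum_(a < n.+1) (-1) ^+ a * ('C(a, i) * fnum a b)%:R) * ((-1) ^+ n * F b).
  rewrite /G mulr_sumr.
  under [RHS]eq_bigr do rewrite mulr_suml.
  rewrite exchange_big /=; apply: eq_bigr => a _.
  rewrite mulrCA eF -1?ltnS ?ltn_ord // mulr_sumr; apply: eq_bigr => b _.
  by rewrite exprD natrM; ring.
rewrite (eq_bigr (fun b : 'I_n.+1 => \sum_(c < n.+1) (fnum i c)%:R *
   ((-1) ^+ (n + b) * ('C(b, c))%:R * F b))); last first.
  move=> b _; rewrite sum_sign_bin_fnum // -sum_bin_stirling2.
  rewrite (_ : \sum_(c < b.+1) _ = \sum_(c < n.+1) 'C(b, c) * stirling2 c i)%N.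
    rewrite exprD natrM natr_sum mulr_sumr !mulr_sumr mulr_suml; apply: eq_bigr => c _.
    by rewrite /fnum !natrM; ring.
  rewrite (big_ord_widen n.+1 (fun c => 'C(b, c) * stirling2 c i)%N) ?ltn_ord // big_mkcond.
  by apply: eq_bigr => c _; case: ltnP => // /bin_small ->.
rewrite exchange_big /=; apply: eq_bigr => c _.
by rewrite /G mulr_sumr.
Qed.
End TopEigenvector.

(** * The numbers [F_{i,d}] and the coefficients of the H-polynomial *)

Lemma Gf_diag b m t : (t <= m)%N -> Gf b m t = Gf b t t.
Proof.
elim: m => [|m IHm]; first by rewrite leqn0 => /eqP->.
by rewrite leq_eqVlt => /predU1P[->//|]; rewrite ltnS => tm /=; rewrite tm IHm.
Qed.

Lemma Gf_step b m : Gf b m.+1 m.+1 =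
  (b`!%:R - (b - m.+1)`!%:R)^-1 *
  \sum_(0 <= t < m.+1) (fnum (b - m.+1) (b - t))%:R * Gf b m t.
Proof.
rewrite /= ltnn RmultE RinvE RminusE !INRE sum_f_R0E; congr (_ * _).
by apply: eq_bigr => t _; rewrite RmultE INRE.
Qed.

Section HPolynomial.
Variable d : nat.
Hypothesis d1 : (0 < d)%N.

Lemma Fc_top : Fc d d.+1 = 1.
Proof. by rewrite /Fc subnn Gf_diag. Qed.

(** This is the defining recursion with denominators cleared; [Gf] counts positions down from the
    top, hence the reversal of the sum. *)
Lemma Fc_rec a : (a <= d)%N ->
  (d.+1`!%:R - a`!%:R) * Fc d a = \sum_(b < d.+2 | (a < b)%N) (fnum a b)%:R * Fc d b.
Proof.
move=> ad; rewrite /Fc [Gf _ _ (_ - a)]Gf_diag ?leq_subr // subSn // Gf_step.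
have -> : (d.+1 - (d - a).+1 = a)%N by lia.
rewrite mulrA mulfV ?mul1r; last by rewrite subr_eq0 eqr_nat gtn_eqF // fact_lt.
rewrite -(big_geq_mkord a.+1 d.+2 predT
  (fun b => (fnum a b)%:R * Gf d.+1 d.+1 (d.+1 - b))).
rewrite -[a.+1]add0n big_addn big_nat_rev.
have -> : (d.+2 - a.+1 = (d - a).+1)%N by lia.
apply: eq_big_nat => i /andP[_ lti].
have -> : (0 + (d - a).+1 - i.+1 = d.+1 - (i + a.+1))%N by lia.
rewrite subKn; last by lia.
by congr (_ * _); rewrite [LHS]Gf_diag; [rewrite [RHS]Gf_diag //; lia | lia].
Qed.

Lemma Fc_eigen a : (a <= d.+1)%N ->
  d.+1`!%:R * Fc d a = \sum_(b < d.+2) (fnum a b)%:R * Fc d b.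
Proof.
rewrite leq_eqVlt => /predU1P[->|].
  rewrite big_ord_recr /= fnum_nn big1 ?add0r // => b _.
  by rewrite fnum_small ?mul0r.
rewrite ltnS => ad; rewrite -[d.+1`!%:R](subrK a`!%:R) mulrDl Fc_rec // addrC.
by rewrite sum_fnum_split // ltnW.
Qed.

Lemma Gf_ge0 b m t : (1 < b)%N -> (m <= b)%N -> 0 <= Gf b m t.
Proof.
move=> b1; elim: m t => [|m IHm] t mb /=; first exact: ler01.
case: ifP => _; first by apply: IHm; lia.
rewrite RmultE RinvE RminusE !INRE sum_f_R0E mulr_ge0 //.
  by rewrite invr_ge0 subr_ge0 ler_nat ltnW // fact_lt //; lia.
by apply: sumr_ge0 => i _; rewrite RmultE INRE mulr_ge0 ?ler0n // IHm //; lia.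
Qed.

(** Row 0 of the eigenvector equation has only its diagonal entry 1, while [(d+1)!] differs from
    1. *)
Lemma Fc0 : Fc d 0 = 0.
Proof.
have := Fc_eigen (leq0n _); rewrite big_ord_recl /= big1 => [/eqP|b _]; last first.
  by rewrite /fnum /= muln0 mul0r.
rewrite mul1r addr0 -subr_eq0 -[X in _ - X]mul1r -mulrBl mulf_eq0 => /orP[|/eqP//].
by rewrite subr_eq0 -[1]/(1%:R) eqr_nat gtn_eqF // (@fact_lt d.+1 d1 0).
Qed.

(** In the recursion the top index contributes [fnum 1 d.+1 = 1], and the other terms are
    nonnegative. Hence [H_d] has degree exactly [d]. *)
Lemma Fc1_gt0 : 0 < Fc d 1.
Proof.
have := Fc_rec d1; rewrite big_mkcond big_ord_recr /= ltnS d1 Fc_top mulr1 /fnum stirling2_1 => E.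
have lt : (1`! < d.+1`!)%N by rewrite fact_lt.
have : 0 < (d.+1`!%:R - 1`!%:R) * Fc d 1.
  rewrite E ltr_wpDl // sumr_ge0 // => b _; case: ifP => // _.
  by rewrite mulr_ge0 ?ler0n //; apply: Gf_ge0.
by rewrite pmulr_rgt0 // subr_gt0 ltr_nat.
Qed.

Lemma HcoefE m : Hcoef d m =
  \sum_(a < d.+2) Fc d a * 'C(d.+1 - a, m)%:R * (-1) ^+ (d.+1 - a - m).
Proof.
rewrite /Hcoef sum_f_R0E big_mkord; apply: eq_bigr => a _.
by rewrite !RmultE INRE /msign RpowE.
Qed.

Lemma Hcoef_large m : (d < m)%N -> Hcoef d m = 0.
Proof.
move=> dm; rewrite HcoefE big_ord_recl /= Fc0 !mul0r add0r big1 // => a _.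
by rewrite bin_small ?mulr0 ?mul0r //; rewrite /bump /=; lia.
Qed.

Lemma Hcoef_lead : Hcoef d d = Fc d 1.
Proof.
rewrite HcoefE !big_ord_recl /= Fc0 !mul0r add0r big1 => [|a _].
  by rewrite /bump addr0 subSS subn0 subnn binn !mulr1.
by rewrite bin_small ?mulr0 ?mul0r //; rewrite /bump /=; lia.
Qed.

(** The constant coefficient is row 0 of [sign_bin_eigenvector], so it equals [Fc d 0]. *)
Lemma Hcoef0 : Hcoef d 0 = 0.
Proof.
rewrite HcoefE -[RHS]Fc0 -[RHS](@sign_bin_eigenvector d.+1 d1 (Fc d)) //; last exact: Fc_eigen.
apply: eq_bigr => a _; rewrite !bin0 !mulr1 subn0 mulrC; congr (_ * _).
by rewrite -signr_odd oddB -1?ltnS ?ltn_ord // -oddD signr_odd.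
Qed.

(** The coefficient of [z] is row 1 of [sign_bin_eigenvector] minus [d + 1] times row 0, whose value
    is zero. *)
Lemma Hcoef1 : Hcoef d 1 = Hcoef d d.
Proof.
have e := Fc_eigen; rewrite Hcoef_lead.
have := @sign_bin_eigenvector d.+1 d1 (Fc d) e 1 isT.
have := @sign_bin_eigenvector d.+1 d1 (Fc d) e 0 isT; rewrite Fc0 => E0 <-.
rewrite HcoefE; set S1 := RHS; have -> : S1 = S1 - d.+1%:R * 0 by rewrite mulr0 subr0.
rewrite -[in RHS]E0 /S1 mulr_sumr -sumrB.
apply: eq_bigr => a _; rewrite bin0 !bin1 mulr1.
have ad := ltn_ord a; rewrite ltnS in ad.
(* At the top index the exponent is truncated, but its factor [d.+1 - a] vanishes. *)
have [->|a_lt] := eqVneq (nat_of_ord a) d.+1.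
  by rewrite subnn mulr0 mul0r; ring.
rewrite natrB // (_ : (-1) ^+ _ = - (-1) ^+ (d.+1 + a)); first by ring.
have a_le : (a <= d)%N by lia.
rewrite subSn // subn1 /= addSn exprS mulN1r opprK.
by rewrite -signr_odd oddB // -oddD signr_odd.
Qed.
End HPolynomial.

(** * Limits of polynomials and of their roots *)

From mathcomp Require Import classical_sets boolp reals topology normedtype sequences.
Import numFieldNormedType.Exports.
Local Open Scope classical_set_scope.

Section NumFieldSequences.
Variable K : numFieldType.
Implicit Types (u v : nat -> K) (l : K).

Lemma cvgn0P u : (u @ \oo --> 0) <->
  (forall e, 0 < e -> exists N, forall k, (N <= k)%N -> `|u k| < e).
Proof.
split=> [/cvgr0Pnorm_lt u0 e /u0 [N _ uN]|u0].
  by exists N => k; apply: uN.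
by apply/cvgr0Pnorm_lt => e /u0 [N uN]; exists N.
Qed.

Lemma cvgnP u l : (u @ \oo --> l) <->
  (forall e, 0 < e -> exists N, forall k, (N <= k)%N -> `|u k - l| < e).
Proof.
by split=> [/subr_cvg0/cvgn0P //|ul]; apply/subr_cvg0/cvgn0P.
Qed.

Lemma cvgn0_le u v M : 0 < M -> v @ \oo --> 0 ->
  (\forall k \near \oo, `|u k| <= M * `|v k|) -> u @ \oo --> 0.
Proof.
move=> M0 v0 [N _ uv]; apply/cvgn0P => e e0.
have [N' vN'] := (cvgn0P v).1 v0 (e / M) (divr_gt0 e0 M0).
exists (maxn N N') => k; rewrite geq_max => /andP[/uv uvk /vN'].
by rewrite ltr_pdivlMr // mulrC => lt; apply: le_lt_trans uvk lt.
Qed.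

Lemma cvgn0_expr u n : (0 < n)%N -> (fun k => u k ^+ n) @ \oo --> 0 -> u @ \oo --> 0.
Proof.
move=> n0 /cvgn0P un0; apply/cvgn0P => e e0.
have [N uN] := un0 _ (exprn_gt0 n e0); exists N => k /uN.
by rewrite normrX ltr_pXn2r // ?nnegrE // ltW.
Qed.

Lemma cvgn_eq_near u v l :
  (\forall k \near \oo, v k = u k) -> v @ \oo --> l -> u @ \oo --> l.
Proof. by move=> uv; apply: cvg_trans; apply: near_eq_cvg. Qed.

Lemma cvgn_sum n (u : nat -> nat -> K) (l : nat -> K) :
  (forall i, (i < n)%N -> (fun k => u k i) @ \oo --> l i) ->
  (fun k => \sum_(i < n) u k i) @ \oo --> \sum_(i < n) l i.
Proof.
elim: n => [|n IHn] ul.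
  rewrite big_ord0; under eq_fun do rewrite big_ord0; exact: cvg_cst.
rewrite big_ord_recr /=; under eq_fun do rewrite big_ord_recr /=.
by apply: cvgD; [apply: IHn => i lt; apply: ul; apply: ltnW | apply: ul].
Qed.

(* Read upwards from the constant one, each coefficient of [- c r Q] is the coefficient of
   [p] plus the previous coefficient divided by [r], and [r -> oo] because [r] dominates the
   sum of the roots of [Q]. *)
Lemma quotient_by_dominant_root d (p Q : nat -> {poly K}) (c r h : nat -> K) :
  (forall k, p k = c k *: (('X - (r k)%:P) * Q k)) ->
  (forall k, (size (Q k) <= d.+2)%N) -> (forall k, (Q k)`_d.+1 = 1) ->
  (forall k, `|(Q k)`_d| <= d.+1%:R * `|r k|) ->
  c @ \oo --> 0 ->
  (forall m, (m <= d.+1)%N -> (fun k => (p k)`_m) @ \oo --> h m) -> h d.+1 != 0 ->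
  [/\ (fun k => (r k)^-1) @ \oo --> 0, \forall k \near \oo, r k != 0 &
      forall m, (m <= d.+1)%N -> (fun k => (Q k)`_m) @ \oo --> h m / h d.+1].
Proof.
move=> pE sQ Q1 Qd c0 ph hd0.
have pS k m : (p k)`_m.+1 = c k * ((Q k)`_m - r k * (Q k)`_m.+1).
  by rewrite pE coefZ mulrBl coefB coefXM /= coefCM.
have p0 k : (p k)`_0 = - (c k * r k) * (Q k)`_0.
  by rewrite pE coefZ mulrBl coefB coefXM /= coefCM sub0r mulrN mulNr mulrA.
(* If [r k = 0], the bound forces coefficient [d] of [Q k] to vanish, and with it coefficient [d.+1]
   of [p k], whose limit is nonzero. *)
have r0 : \forall k \near \oo, r k != 0.
  apply: filterS (cvgr_neq0 _ (ph _ (leqnn _)) hd0) => k; apply: contra_neq => rk0.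
  have := Qd k; rewrite rk0 normr0 mulr0 normr_le0 pS rk0 => /eqP->.
  by rewrite mul0r subr0 mulr0.
have rV0 : (fun k => (r k)^-1) @ \oo --> 0.
  have cp0 : (fun k => c k / (p k)`_d.+1) @ \oo --> 0.
    rewrite -[X in _ --> X](mul0r (h d.+1)^-1).
    by apply: cvgM => //; apply: cvgV => //; exact: (ph _ (leqnn _)).
  (* Coefficient [d.+1] of [p k] is [c k] times the difference of coefficient [d] of [Q k] and
     [r k], so its modulus is at most [(d + 2) |c k| |r k|]. *)
  apply: (@cvgn0_le _ _ d.+2%:R) cp0 _; first by rewrite ltr0n.
  near=> k.
  have rk0 : r k != 0 by near: k.
  have pk0 : (p k)`_d.+1 != 0 by near: k; exact: (cvgr_neq0 _ (ph _ (leqnn _)) hd0).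
  rewrite normfV normrM normfV mulrA ler_pdivlMr ?normr_gt0 // mulrC.
  rewrite ler_pdivrMr ?normr_gt0 // pS Q1 mulr1 normrM [_ * `|c k|]mulrC -mulrA.
  rewrite ler_wpM2l //; apply: (le_trans (ler_normB _ _)).
  by rewrite -[d.+2]addn1 natrD mulrDl mul1r lerD2r; apply: Qd.
have gh m : (m <= d.+1)%N -> (fun k => - (c k * r k) * (Q k)`_m) @ \oo --> h m.
  elim: m => [|m IHm] md; first by under eq_fun do rewrite -p0; exact: ph.
  have lim : (fun k => (p k)`_m.+1 + (- (c k * r k) * (Q k)`_m) * (r k)^-1) @ \oo --> h m.+1.
    rewrite -[h m.+1]addr0 -[X in _ + X](mulr0 (h m)).
    by apply: cvgD; [exact: ph | apply: cvgM => //; exact: IHm (ltnW md)].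
  apply: cvgn_eq_near lim; near=> k.
  have rk0 : r k != 0 by near: k.
  by rewrite pS; field.
split=> // m md.
have lim : (fun k => (- (c k * r k) * (Q k)`_m) / (- (c k * r k) * (Q k)`_d.+1))
   @ \oo --> h m / h d.+1.
  by apply: cvgM; [exact: gh | apply: cvgV => //; exact: gh].
apply: cvgn_eq_near lim; near=> k.
have : - (c k * r k) * (Q k)`_d.+1 != 0.
  by near: k; exact: (cvgr_neq0 _ (gh _ (leqnn _)) hd0).
rewrite Q1 mulr1 oppr_eq0 mulf_eq0 negb_or => /andP[ck0 rk0].
by field; rewrite ?ck0 ?rk0.
Unshelve. all: by end_near. Qed.

(** Division of the value by [z k ^+ d] leaves a polynomial in the inverse of [z k], which tends to
    [q d]. *)
Lemma nonvanishing_at_infinity d (Q : nat -> {poly K}) (q z : nat -> K) :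
  (forall k, (size (Q k) <= d.+1)%N) ->
  (forall m, (m <= d)%N -> (fun k => (Q k)`_m) @ \oo --> q m) -> q d != 0 ->
  (\forall k \near \oo, z k != 0) -> (fun k => (z k)^-1) @ \oo --> 0 ->
  \forall k \near \oo, (Q k).[z k] != 0.
Proof.
move=> sQ Qq qd0 z0 zV0.
have lim : (fun k => \sum_(i < d.+1) (Q k)`_i * (z k)^-1 ^+ (d - i)) @ \oo --> q d.
  have -> : q d = \sum_(i < d.+1) q i * 0 ^+ (d - i).
    rewrite big_ord_recr /= subnn expr0 mulr1 big1 ?add0r // => i _.
    by rewrite expr0n subn_eq0 leqNgt ltn_ord mulr0.
  apply: (@cvgn_sum d.+1 (fun k i => (Q k)`_i * (z k)^-1 ^+ (d - i))
    (fun i => q i * 0 ^+ (d - i))) => i id.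
  apply: cvgM; first exact: Qq.
  elim: (d - i)%N => [|j IHj]; first by under eq_fun do rewrite expr0; exact: cvg_cst.
  by under eq_fun do rewrite exprS; rewrite exprS; apply: cvgM.
near=> k.
have zk0 : z k != 0 by near: k.
have : \sum_(i < d.+1) (Q k)`_i * (z k)^-1 ^+ (d - i) != 0.
  by near: k; exact: (cvgr_neq0 _ lim qd0).
apply: contra_neq => Qk0; apply: (mulfI (expf_neq0 d zk0)); rewrite mulr0 -[RHS]Qk0.
rewrite (horner_coef_wide _ (sQ k)) mulr_sumr; apply: eq_bigr => i _.
have id : (i <= d)%N by rewrite -ltnS.
rewrite mulrCA exprVn; congr (_ * _); apply: (mulIf (expf_neq0 (d - i) zk0)).
by rewrite divfK ?expf_neq0 // -exprD subnKC.
Unshelve. all: by end_near. Qed.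

(** Synthetic division, run downwards from the vanishing high coefficients, uses only sums and
    products, and so passes to the limit. *)
Lemma deflation_cvg n (p' : nat -> {poly K}) (P' : {poly K}) (a : nat -> K) l :
  (forall k, (size (p' k) <= n)%N) -> (size P' <= n)%N -> a @ \oo --> l ->
  (forall m, (fun k => (('X - (a k)%:P) * p' k)`_m) @ \oo --> (('X - l%:P) * P')`_m) ->
  forall m, (fun k => (p' k)`_m) @ \oo --> P'`_m.
Proof.
move=> sp sP al lim m.
have coefS (b : K) (g : {poly K}) i : g`_i = (('X - b%:P) * g)`_i.+1 + b * g`_i.+1.
  by rewrite mulrBl coefB coefXM /= coefCM subrK.
have [nm|] := leqP n m.
  rewrite nth_default ?(leq_trans sP) //.
  by under eq_fun do rewrite nth_default ?(leq_trans (sp _)) //; exact: cvg_cst.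
move/ltnW/subKn <-; elim: (n - m)%N => [|j IHj].
  rewrite subn0 nth_default //.
  by under eq_fun do rewrite nth_default //; exact: cvg_cst.
have [jn|nj] := ltnP j n; last first.
  by have -> : (n - j.+1 = n - j)%N by lia.
have E : ((n - j.+1).+1 = n - j)%N by lia.
rewrite (coefS l) E; under eq_fun => k do rewrite (coefS (a k)) E.
by apply: cvgD => //; apply: cvgM.
Qed.

Lemma horner_cvg n (p : nat -> {poly K}) (P : {poly K}) z :
  (forall k, (size (p k) <= n)%N) -> (size P <= n)%N ->
  (forall m, (fun k => (p k)`_m) @ \oo --> P`_m) -> (fun k => (p k).[z]) @ \oo --> P.[z].
Proof.
move=> sp sP pP; rewrite (horner_coef_wide _ sP).
under eq_fun => k do rewrite (horner_coef_wide _ (sp k)).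
apply: (@cvgn_sum n (fun k i => (p k)`_i * z ^+ i) (fun i => P`_i * z ^+ i)) => i _.
by apply: cvgM => //; exact: cvg_cst.
Qed.

Lemma closest_root_le (s : seq K) (z x : K) :
  (forall y, y \in s -> `|z - x| <= `|z - y|) ->
  `|z - x| ^+ size s <= `|(\prod_(y <- s) ('X - y%:P)).[z]|.
Proof.
elim: s => [|y s IHs] min; first by rewrite big_nil hornerC normr1.
rewrite big_cons hornerM hornerXsubC normrM exprS ler_pM ?exprn_ge0 //.
  by apply: min; rewrite mem_head.
by apply: IHs => u us; apply: min; rewrite in_cons us orbT.
Qed.

Lemma exists_closest (s : seq K) (z : K) : s != [::] ->
  exists2 x, x \in s & forall y, y \in s -> `|z - x| <= `|z - y|.
Proof.
elim: s => // x s IHs _; have [->|/IHs [u us min]] := eqVneq s [::].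
  by exists x; rewrite ?mem_head // => y; rewrite inE => /eqP->.
have [le|/ltW le] := real_leP (normr_real (z - x)) (normr_real (z - u)).
  exists x; rewrite ?mem_head // => y; rewrite inE => /predU1P[->//|/min].
  exact: le_trans.
exists u; first by rewrite in_cons us orbT.
by move=> y; rewrite inE => /predU1P[->//|/min].
Qed.

(** Each factor at [z] has modulus at least [|z - x k|], so the [n]-th power of this distance is
    bounded by a value tending to [Q.[z] = 0]. *)
Lemma closest_root_cvg n (s : nat -> seq K) (x : nat -> K) (Q : {poly K}) z :
  (0 < n)%N -> (forall k, size (s k) = n) -> (size Q <= n.+1)%N -> root Q z ->
  (forall m, (fun k => (\prod_(y <- s k) ('X - y%:P))`_m) @ \oo --> Q`_m) ->
  (forall k y, y \in s k -> `|z - x k| <= `|z - y|) ->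
  x @ \oo --> z.
Proof.
move=> n0 sn sQ /rootP Qz sQlim min.
have ev : (fun k => (\prod_(y <- s k) ('X - y%:P)).[z]) @ \oo --> 0.
  by rewrite -Qz; apply: (@horner_cvg n.+1) => // k; rewrite size_prod_XsubC sn.
apply/subr_cvg0; apply: (cvgn0_expr n0); apply: (cvgn0_le ltr01 ev).
by near=> k; rewrite mul1r normrX distrC -{1}(sn k); apply: closest_root_le; exact: min.
Unshelve. all: by end_near. Qed.
End NumFieldSequences.

Section RootContinuity.
Variable K : numClosedFieldType.


(* A root of the limit attracts the closest root of the [k]-th polynomial; deflate and repeat. *)
Lemma root_continuity n (s : nat -> seq K) (Q : {poly K}) :
  (forall k, size (s k) = n) -> size Q = n.+1 ->
  (forall m, (fun k => (\prod_(y <- s k) ('X - y%:P))`_m) @ \oo --> Q`_m) ->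
  exists (t : nat -> seq K) (L : nat -> K), (forall k, perm_eq (t k) (s k)) /\
    forall i, (i < n)%N -> (fun k => (t k)`_i) @ \oo --> L i.
Proof.
elim: n s Q => [|n IHn] s Q sn sQ lim; first by exists s, (fun=> 0).
have /closed_rootP [z Qz] : size Q != 1%N by rewrite sQ.
have [x xmin] : {x : nat -> K & forall k, x k \in s k /\
    forall y, y \in s k -> `|z - x k| <= `|z - y|}.
  apply: (@choice _ _ (fun k u => u \in s k /\ forall y, y \in s k -> `|z - u| <= `|z - y|)) => k.
  have [|u us umin] := @exists_closest _ (s k) z; last by exists u.
  by rewrite -size_eq0 sn.
have xz : x @ \oo --> z.
  apply: (closest_root_cvg (ltn0Sn n) sn) lim _ => //; first by rewrite sQ.
  by move=> k; case: (xmin k).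
have [Q' QE] := factor_theorem Q z Qz.
have Q'0 : Q' != 0 by apply: contra_eq_neq sQ => Q'0; rewrite QE Q'0 mul0r size_poly0.
have sQ' : size Q' = n.+1.
  by move: sQ; rewrite QE size_Mmonic ?monicXsubC // size_XsubC addn2 => -[].
have sn' k : size (rem (x k) (s k)) = n by rewrite size_rem ?sn //; case: (xmin k).
have sE k : \prod_(y <- s k) ('X - y%:P) =
    ('X - (x k)%:P) * \prod_(y <- rem (x k) (s k)) ('X - y%:P).
  by rewrite (perm_big _ (perm_to_rem (xmin k).1)) big_cons.
have [|t [L [tp tL]]] := IHn (fun k => rem (x k) (s k)) Q' sn' sQ'.
  apply: (@deflation_cvg _ n.+1) xz _ => [k||m]; first by rewrite size_prod_XsubC sn'.
    by rewrite sQ'.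
  by under eq_fun do rewrite -sE; rewrite mulrC -QE; exact: lim.
exists (fun k => x k :: t k), (fun i => if i is i'.+1 then L i' else z); split=> [k|[|i] //].
  rewrite perm_sym (permPl (perm_to_rem (xmin k).1)) perm_cons perm_sym; exact: tp.
exact: tL.
Qed.
End RootContinuity.

(** * Growth of face numbers under iteration *)

Lemma affine_recurrence_cvg (K : archiRealFieldType) (y e : nat -> K) (q l : K) :
  `|q| < 1 -> (forall k, y k.+1 = q * y k + e k) -> e @ \oo --> (1 - q) * l ->
  y @ \oo --> l.
Proof.
move=> q1 yS el; apply/subr_cvg0/cvgn0P => eps eps0.
have q1' : 0 < 1 - `|q| by rewrite subr_gt0.
have e20 : 0 < eps / 2 by rewrite divr_gt0.
(* With error below [eps / 2 * (1 - |q|)], the value [eps / 2] is a fixed point of the resulting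
   bound. *)
have /cvgn0P/(_ _ (mulr_gt0 e20 q1')) [N eN] : (fun k => e k - (1 - q) * l) @ \oo --> 0.
  exact/subr_cvg0.
have bound j : `|y (N + j)%N - l| <= `|q| ^+ j * `|y N - l| + eps / 2.
  elim: j => [|j IHj]; first by rewrite addn0 mul1r lerDl ltW.
  rewrite addnS yS.
  have -> : q * y (N + j)%N + e (N + j)%N - l =
     q * (y (N + j)%N - l) + (e (N + j)%N - (1 - q) * l) by ring.
  apply: (le_trans (ler_normD _ _)); rewrite normrM exprS.
  have := ler_wpM2l (normr_ge0 q) IHj; have := eN _ (leq_addr j N).
  nra.
have /cvgn0P/(_ _ e20) [M qM] : (fun j => `|q| ^+ j * `|y N - l|) @ \oo --> (0 : K).
  rewrite -[X in _ --> X](mul0r (`|y N - l|)).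
  by apply: cvgM; [apply: cvg_expr; rewrite normr_id | exact: cvg_cst].
exists (N + M)%N => k Nk.
have -> : k = (N + (k - N))%N by lia.
apply: (le_lt_trans (bound _)).
have := qM (k - N)%N ltac:(lia); rewrite ger0_norm ?mulr_ge0 ?exprn_ge0 //; lra.
Qed.

(** After division by [n! ^ k], coordinate [a < n] obeys an affine recurrence of ratio
    [a! / n! < 1], forced only by larger indices. The induction descends from index [n], where the
    sequence is constant. *)
Lemma eigenvector_growth (K : archiRealFieldType) (n : nat) (f : nat -> nat -> K)
    (F : nat -> K) : (1 < n)%N ->
  (forall k a, f k.+1 a = \sum_(b < n.+1) (fnum a b)%:R * f k b) ->
  (forall a, (a <= n)%N -> n`!%:R * F a = \sum_(b < n.+1) (fnum a b)%:R * F b) ->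
  F n = 1 ->
  forall a, (a <= n)%N -> (fun k => f k a / n`!%:R ^+ k) @ \oo --> f 0%N n * F a.
Proof.
move=> n1 fS eF Fn a an.
have nf0 : n`!%:R != 0 :> K by rewrite pnatr_eq0 -lt0n fact_gt0.
have xS k b : (b <= n)%N -> f k.+1 b / n`!%:R ^+ k.+1 = (b`!%:R / n`!%:R) * (f k b / n`!%:R ^+ k)
    + n`!%:R^-1 * \sum_(c < n.+1 | (b < c)%N) (fnum b c)%:R * (f k c / n`!%:R ^+ k).
  move=> bn; rewrite -mulrA mulrCA -mulrDr.
  rewrite -(sum_fnum_split (fun c => f k c / n`!%:R ^+ k) bn) fS exprS invfM mulrCA.
  by congr (_ * _); rewrite mulr_suml; apply: eq_bigr => c _; rewrite mulrA.
have -> : a = (n - (n - a))%N by rewrite subKn.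
have := leq_subr a n; move: (n - a)%N => {an a} t.
elim/ltn_ind: t => t IH tn.
have [->|t0] := posnP t.
  rewrite subn0 Fn mulr1; under eq_fun => k.
    have -> : f k n / n`!%:R ^+ k = f 0%N n.
      elim: k => [|k IHk]; first by rewrite expr0 divr1.
      rewrite xS // IHk mulfV // mul1r big1 ?mulr0 ?addr0 // => c nc.
      by have := ltn_ord c; lia.
    over.
  exact: cvg_cst.
set a := (n - t)%N; have a_lt : (a < n)%N by lia.
apply: (@affine_recurrence_cvg _ _ (fun k => n`!%:R^-1 *
    \sum_(c < n.+1 | (a < c)%N) (fnum a c)%:R * (f k c / n`!%:R ^+ k)) (a`!%:R / n`!%:R)); last first.
- pose e (c : nat -> K) b := if (a < b)%N then (fnum a b)%:R * c b else 0.
  (* Row [a] of the eigenvector equation, divided by [n!], identifies the limit of the forcing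
     term. *)
  have -> : (1 - a`!%:R / n`!%:R) * (f 0%N n * F a)
      = n`!%:R^-1 * \sum_(b < n.+1) e (fun b => f 0%N n * F b) b.
    rewrite -big_mkcond /=; under eq_bigr do rewrite mulrCA.
    rewrite -mulr_sumr; have := eF a (ltnW a_lt).
    rewrite (sum_fnum_split _ (ltnW a_lt)) addrC => /eqP; rewrite -subr_eq => /eqP <-.
    by field.
  apply: cvgM; first exact: cvg_cst.
  under eq_fun do rewrite big_mkcond /=.
  apply: (@cvgn_sum _ _ (fun k => e (fun b => f k b / n`!%:R ^+ k))) => b bn.
  rewrite /e; case: ifP => [ab|_]; last exact: cvg_cst.
  apply: cvgM; first exact: cvg_cst.
  have -> : b = (n - (n - b))%N by lia.
  by apply: IH; lia.
- by move=> k; rewrite xS // ltnW.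
rewrite ger0_norm ?divr_ge0 ?ler0n // ltr_pdivrMr ?mul1r ?ltr_nat ?fact_lt //.
by rewrite ltr0n fact_gt0.
Qed.

Lemma coef_XsubC1_exp (K : comNzRingType) k m :
  (('X - 1%:P : {poly K}) ^+ k)`_m = 'C(k, m)%:R * (-1) ^+ (k - m).
Proof.
elim: k m => [|k IHk] m.
  by rewrite expr0 coef1 bin0n sub0n expr0 mulr1.
rewrite exprS mulrBl mul1r coefB coefXM; case: m => [|m] /=.
  by rewrite sub0r IHk !bin0 !subn0 exprS mul1r mulN1r mul1r.
rewrite !IHk binS subSS natrD mulrDl addrC.
have [mk|km] := leqP m.+1 k; last by rewrite bin_small // !mul0r oppr0.
have -> : (k - m = (k - m.+1).+1)%N by lia.
by rewrite exprS; ring.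
Qed.

(** The naturals provide more zeros of [p - q] than its degree allows. *)
Lemma eq_poly_horner (K : numDomainType) (p q : {poly K}) :
  (forall z, p.[z] = q.[z]) -> p = q.
Proof.
move=> pq; apply/eqP; rewrite -subr_eq0; apply/negPn/negP => nz.
pose rs : seq K := [seq i%:R | i <- iota 0 (size (p - q))].
have := @max_poly_roots _ _ rs nz; rewrite size_map size_iota ltnn => H.
suff : false by []; apply: H.
  by apply/allP => z _; rewrite rootE hornerD hornerN pq subrr.
rewrite map_inj_uniq ?iota_uniq // => i j /eqP; rewrite eqr_nat; exact: eqP.
Qed.

(** * Complex numbers as pairs *)

Local Open Scope complex_scope.

(* Named so that the topology of an abstract [numClosedFieldType] is found on [R[i]]. *)
Definition Cnum : numClosedFieldType := R[i].
Definition Rnum : archiRealFieldType := R.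

Definition toC (z : Cx) : R[i] := z.1 +i* z.2.
Definition ofC (z : R[i]) : Cx := (complex.Re z, complex.Im z).

Lemma ofCK : cancel ofC toC. Proof. by case. Qed.
Lemma toC_real (x : R) : toC (RtoC x) = x%:C. Proof. by []. Qed.
Lemma toCD z w : toC (Cadd z w) = toC z + toC w. Proof. by []. Qed.
Lemma toCB z w : toC (Csub z w) = toC z - toC w. Proof. by []. Qed.
Lemma toCM z w : toC (Cmul z w) = toC z * toC w.
Proof. by case: z w => [a b] [c e]. Qed.

Lemma toCX z n : toC (Cpow z n) = toC z ^+ n.
Proof. by elim: n => [|n IHn] //=; rewrite toCM IHn exprS. Qed.

Lemma toC_sum f n : toC (Csum f n) = \sum_(i < n) toC (f i).
Proof. by elim: n => [|n IHn]; rewrite ?big_ord0 // big_ord_recr /= toCD IHn. Qed.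

Lemma toC_prod f n : toC (Cprod f n) = \prod_(i < n) toC (f i).
Proof. by elim: n => [|n IHn]; rewrite ?big_ord0 // big_ord_recr /= toCM IHn. Qed.

Lemma norm_toC z : `|toC z| = (Cnorm z)%:C.
Proof. by rewrite normc_def /Cnorm RsqrtE !RmultE RplusE !expr2. Qed.

Lemma Cnorm_le z w : Rle (Cnorm z) (Cnorm w) -> `|toC z| <= `|toC w|.
Proof. by move=> /RleP; rewrite !norm_toC lecR. Qed.

Definition linear_factors (r : nat -> Cx) (m n : nat) : {poly R[i]} :=
  \prod_(m <= i < n) ('X - (toC (r i))%:P).

Lemma coef_linear_factors r n m : (linear_factors r 0 n)`_m = toC (prodcoef r n m).
Proof.
rewrite /linear_factors; elim: n m => [|n IHn] m.
  by rewrite big_nil coef1 /=; case: eqP.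
rewrite big_nat_recr //= mulrC mulrBl coefB coefXM coefCM toCB toCM IHn.
by case: m => [|m] //=; rewrite IHn.
Qed.

(** The coefficients stay real so that nonreal zeros come in conjugate pairs. *)
Definition hpoly_of (f : nat -> R) (n : nat) : {poly R} :=
  \sum_(a < n.+1) f a *: ('X - 1%:P) ^+ (n - a).

Lemma coef_hpoly_of f n m :
  (hpoly_of f n)`_m = \sum_(a < n.+1) f a * ('C(n - a, m)%:R * (-1) ^+ (n - a - m)).
Proof. by rewrite coef_sum; apply: eq_bigr => a _; rewrite coefZ coef_XsubC1_exp. Qed.

Lemma toC_hpoly (T : finType) (D : {set {set T}}) z :
  toC (hpoly D z) =
  (map_poly (real_complex R) (hpoly_of (fun a => (fcount D a)%:R) (cdim D).+1)).[toC z].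
Proof.
rewrite /hpoly toC_sum /hpoly_of raddf_sum horner_sum; apply: eq_bigr => a _ /=.
rewrite toCM toC_real toCX toCB toC_real INRE map_polyZ rmorphXn rmorphB /= map_polyX map_polyC.
by rewrite hornerZ horner_exp hornerXsubC.
Qed.

Lemma Un_cv_Cnorm (u : nat -> Cx) :
  (fun k => toC (u k) : Cnum) @ \oo --> (0 : Cnum) -> Un_cv (fun k => Cnorm (u k)) 0%R.
Proof.
move=> /cvgn0P u0 eps /RltP eps0; have [|N uN] := u0 eps%:C.
  by change (0 < eps%:C); rewrite ltcR.
exists N => k /ssrnat.leP Nk; have : `|toC (u k)| < eps%:C := uN k Nk; rewrite norm_toC ltcR => lt.
have n0 : 0 <= Cnorm (u k) by rewrite -lecR -norm_toC normr_ge0.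
by apply/RltP; rewrite RdistE subr0 ger0_norm.
Qed.

Lemma Ccv_toC (u : nat -> Cx) L :
  (fun k => toC (u k) : Cnum) @ \oo --> (toC L : Cnum) -> Ccv u L.
Proof.
move=> ul; apply: (@Un_cv_Cnorm (fun k => Csub (u k) L)).
exact: ((subr_cvg0 _ _).2 ul).
Qed.

Lemma cv_infty_Cnorm (u : nat -> Cx) : (\forall k \near \oo, toC (u k) != 0) ->
  (fun k => (toC (u k))^-1 : Cnum) @ \oo --> (0 : Cnum) -> cv_infty (fun k => Cnorm (u k)).
Proof.
move=> [N _ u0] /cvgn0P uV0 M; pose M' := (`|M| + 1 : R).
have M'0 : 0 < M' by rewrite ltr_wpDl.
have [|N' uN'] := uV0 (M'^-1)%:C.
  by change (0 < (M'^-1)%:C); rewrite ltcR invr_gt0.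
exists (maxn N N') => k /ssrnat.leP; rewrite geq_max => /andP[/u0 /= uk0 /uN'].
change (`|(toC (u k))^-1| < (M'^-1)%:C -> Rlt M (Cnorm (u k))).
rewrite normfV norm_toC -fmorphV ltcR ltf_pV2 ?posrE //; last first.
  by rewrite -ltcR -norm_toC normr_gt0.
by move=> lt; apply/RltP; apply: le_lt_trans (ler_norm M) _; apply: lt_trans lt; rewrite ltrDl.
Qed.

Lemma cvg_real_complex (u : nat -> Rnum) (l : Rnum) :
  u @ \oo --> l -> (fun k => (u k)%:C : Cnum) @ \oo --> (l%:C : Cnum).
Proof.
move=> ul; apply: (cvgnP _ _).2 => e e0.
have e0' : (0 : R[i]) < e by [].
(* A positive complex number is real, so its real part serves as threshold. *)
have eE : e = (complex.Re e)%:C by rewrite RRe_real // gtr0_real.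
have [|N uN] := (cvgnP u l).1 ul (complex.Re e); first by change (0 < complex.Re e); rewrite -ltcR -eE.
exists N => k /uN lt; change (`|(u k)%:C - l%:C : R[i]| < e); rewrite eE -rmorphB.
by rewrite normc_def /= expr0n addr0 sqrtr_sqr ltcR.
Qed.

Lemma nonreal_root_conj (p : {poly R}) (Q : {poly R[i]}) (r : R[i]) :
  map_poly (real_complex R) p = ('X - r%:P) * Q -> r^*%C != r -> Q.[r^*%C] = 0.
Proof.
move=> pE ne.
have : root (map_poly (real_complex R) p) r^*%C.
  rewrite -complex_root_conj -map_poly_comp /=.
  rewrite (eq_map_poly (g := real_complex R)); last by move=> x /=; exact: conjc_real.
  by rewrite pE rootM root_XsubC eqxx.
rewrite pE rootM root_XsubC (negPf ne) /=; exact: rootP.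
Qed.

Lemma linear_factorsE r m n :
  linear_factors r m n = \prod_(y <- [seq toC (r i) | i <- index_iota m n]) ('X - y%:P).
Proof. by rewrite big_map. Qed.

Lemma size_linear_factors r m n : size (linear_factors r m n) = (n - m).+1.
Proof. by rewrite linear_factorsE size_prod_XsubC size_map size_iota. Qed.

(** The coefficient is minus the sum of the [n + 1] roots. This supplies the dominance bound for
    [quotient_by_dominant_root]. *)
Lemma coef_pred_linear_factors_le r n (b : R[i]) : (forall i, (i < n.+1)%N -> `|toC (r i)| <= b) ->
  `|(linear_factors r 0 n.+1)`_n| <= n.+1%:R * b.
Proof.
move=> rb; rewrite linear_factorsE.
have := @coefPn_prod_XsubC _ [seq toC (r i) | i <- index_iota 0 n.+1].
rewrite size_map size_iota => -> //; rewrite normrN big_map big_mkord.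
apply: (le_trans (ler_norm_sum _ _ _)).
have -> : n.+1%:R * b = \sum_(i < n.+1) b by rewrite sumr_const card_ord mulr_natl.
by apply: ler_sum => i _; exact: rb.
Qed.

(** * Rescaled h-polynomials of the iterated subdivisions *)

Section Subdivisions.
Variables (T : finType) (D : {set {set T}}) (d : nat).
Hypotheses (Dc : is_complex D) (Dd : cdim D = d) (d1 : (0 < d)%N).

Let f k a : R := (fcount (bsd_iter D k) a)%:R.
Let scale k : R := (fcount D d.+1)%:R * d.+1`!%:R ^+ k.

(** The predecessor in [cdim] is truncated; [0 < d] excludes a maximum of zero. *)
Lemma max_cardE : (\max_(s in D) #|s|)%N = d.+1.
Proof. by move: Dd d1; rewrite /cdim; case: (\max_(s in D) _)%N => [<-|n /= ->]. Qed.

Lemma cdim_bsd_iter k : cdim (bsd_iter D k) = d.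
Proof. by rewrite /cdim max_card_bsd_iter // max_cardE. Qed.

Lemma top_count_gt0 : 0 < (fcount D d.+1)%:R :> R.
Proof. by rewrite ltr0n -max_cardE fcount_max_gt0. Qed.

Lemma scaled_hpoly_cvg m :
  (fun k => ((scale k)^-1 *: hpoly_of (f k) d.+1)`_m : Rnum) @ \oo --> (Hcoef d m : Rnum).
Proof.
have fn0 := lt0r_neq0 top_count_gt0.
have lim := @eigenvector_growth Rnum d.+1 f (Fc d) d1 _ (Fc_eigen d1) (Fc_top d).
under eq_fun => k.
  rewrite coefZ coef_hpoly_of mulr_sumr.
  under eq_bigr => a _ do rewrite mulrA.
  over.
rewrite HcoefE.
apply: (@cvgn_sum Rnum d.+2
  (fun k a => (scale k)^-1 * f k a * ('C(d.+1 - a, m)%:R * (-1) ^+ (d.+1 - a - m)))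
  (fun a => Fc d a * 'C(d.+1 - a, m)%:R * (-1) ^+ (d.+1 - a - m))) => a ad.
rewrite -mulrA; apply: cvgM; last exact: cvg_cst.
have -> : Fc d a = (fcount D d.+1)%:R^-1 * (f 0%N d.+1 * Fc d a).
  by rewrite /f /= mulrA mulVf // mul1r.
under eq_fun => k.
  rewrite /scale invfM -mulrA [_^-1 * f k a]mulrC; over.
apply: cvgM; first exact: cvg_cst.
apply: lim => //.
move=> k b; rewrite /f fcount_bsd_iterS // max_cardE natr_sum.
by apply: eq_bigr => c _; rewrite natrM.
Qed.

Lemma scale_cvg : (fun k => (scale k)^-1 : Rnum) @ \oo --> (0 : Rnum).
Proof.
rewrite -[X in _ --> X](mulr0 (fcount D d.+1)%:R^-1).
under eq_fun do rewrite /scale invfM -exprVn.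
apply: cvgM; first exact: cvg_cst.
apply: cvg_expr; rewrite normfV ger0_norm ?ler0n // invf_lt1 ?ltr0n ?fact_gt0 //.
by rewrite ltr1n (@fact_lt d.+1 d1 0).
Qed.
End Subdivisions.

(** * Roots of the h-polynomials *)

(** [root_continuity] reorders lists of values; [sigma] lifts the reordering to labels, so that
    repeated roots keep distinct labels. *)
Lemma labelled_roots_cvg n (r : nat -> nat -> Cx) (Q : {poly Cnum}) : (0 < n)%N ->
  size Q = n ->
  (forall m, (fun k => (linear_factors (r k) 1 n)`_m : Cnum) @ \oo --> Q`_m) ->
  exists sigma : nat -> nat -> nat,
    [/\ forall k i, (0 < i < n)%N -> (0 < sigma k i < n)%N,
        forall k i j, (0 < i < n)%N -> (0 < j < n)%N -> sigma k i = sigma k j -> i = j &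
        forall i, (0 < i < n)%N -> exists L,
          (fun k => toC (r k (sigma k i)) : Cnum) @ \oo --> (toC L : Cnum)].
Proof.
move=> n0 sQ Qlim; pose s k : seq Cnum := [seq toC (r k i) | i <- index_iota 1 n].
have ss k : size (s k) = n.-1 by rewrite size_map size_iota subn1.
have [] := @root_continuity _ n.-1 s Q ss; first by rewrite sQ prednK.
  by move=> m; under eq_fun do rewrite -linear_factorsE; exact: Qlim.
move=> t [L [ts tL]].
have [Is IsP] : {Is : nat -> seq nat & forall k, perm_eq (Is k) (iota 0 n.-1) /\
    t k = [seq nth 0 (s k) i | i <- Is k]}.
  apply: (@boolp.choice _ _ (fun k I => perm_eq I (iota 0 n.-1) /\
    t k = [seq nth 0 (s k) i | i <- I])) => k.
  by have /(perm_iotaP 0) [I] := ts k; rewrite ss => pI tE; exists I.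
have sI k : size (Is k) = n.-1 by rewrite (perm_size (IsP k).1) size_iota.
have ltI k i : (0 < i < n)%N -> (nth 0%N (Is k) i.-1 < n.-1)%N.
  move=> /andP[i0 i_n]; have : nth 0%N (Is k) i.-1 \in iota 0 n.-1.
    by rewrite -(perm_mem (IsP k).1) mem_nth // sI; lia.
  by rewrite mem_iota.
(* List positions start at 0, root labels at 1. *)
exists (fun k i => (nth 0%N (Is k) i.-1).+1); split.
- by move=> k i /(ltI k); lia.
- move=> k i j iP jP [] /eqP; rewrite nth_uniq ?sI; try lia.
  by rewrite (perm_uniq (IsP k).1) iota_uniq.
move=> i iP; exists (ofC (L i.-1)); rewrite ofCK.
have := tL i.-1; have -> : (i.-1 < n.-1)%N by lia.
move=> /(_ isT); apply: cvg_trans; apply: near_eq_cvg; near=> k.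
have ltIk := ltI k i iP.
rewrite (IsP k).2 (nth_map 0%N) ?sI; last by lia.
rewrite (nth_map 0%N) ?size_iota; last by lia.
by rewrite nth_iota ?subn1 // add1n.
Unshelve. all: by end_near. Qed.

(* [ssralg] rebinds the key %R to [ring_scope]; the statement below needs Stdlib's binding. *)
Delimit Scope R_scope with R.

(* rinf k = ρ^(k)_∞,  rho k i = ρ^(k)_i  (0 <= i < d) *)
Theorem theorem1p1 (T : finType) (D : {set {set T}}) (d : nat)
    (rinf : nat -> Cx) (rho : nat -> nat -> Cx) :
  is_complex D -> cdim D = d -> (1 <= d)%nat ->
  (* the d+1 zeros, with multiplicity, of h^{Δ^(k)} *)
  (forall (k : nat) (z : Cx),
      hpoly (bsd_iter D k) z =
      Cmul (Csub z (rinf k)) (Cprod (fun i => Csub z (rho k i)) d)) ->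
  (* ρ_∞ has maximal modulus, ρ_0 minimal modulus *)
  (forall k i : nat, (i < d)%nat ->
      (Cnorm (rho k i) <= Cnorm (rinf k))%R /\ (Cnorm (rho k 0%nat) <= Cnorm (rho k i))%R) ->
  (* (1) *)
  Un_cv (fun k => Cnorm (rho k 0%nat)) 0%R /\
  (exists sigma : nat -> nat -> nat,
      (forall k i, (0 < i < d)%nat -> (0 < sigma k i < d)%nat) /\
      (forall k i j, (0 < i < d)%nat -> (0 < j < d)%nat ->
          sigma k i = sigma k j -> i = j) /\
      (forall i, (0 < i < d)%nat -> exists L : Cx, Ccv (fun k => rho k (sigma k i)) L)) /\
  (* (2) *)
  (exists N : nat, forall k : nat, (N <= k)%nat -> snd (rinf k) = 0%R) /\
  cv_infty (fun k => Cnorm (rinf k)) /\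
  (* (3) coefficientwise convergence of H_{1,d} prod_{i<d} (z - ρ_i) to H_d *)
  (forall m : nat,
      Ccv (fun k => Cmul (RtoC (Hcoef d d)) (prodcoef (rho k) d m)) (RtoC (Hcoef d m))) /\
  (* (4) *)
  Ccv (fun k => Cprod (fun i => rho k i.+1) d.-1) (RtoC (msign d.-1)).
Proof.
move=> Dc Dd d1 roots order.
pose scale k : R := ((fcount D d.+1)%:R * d.+1`!%:R ^+ k).
pose h k : {poly R} := hpoly_of (fun a => (fcount (bsd_iter D k) a)%:R) d.+1.
pose r k : Cnum := toC (rinf k).
pose Q k : {poly Cnum} := linear_factors (rho k) 0 d.
pose H m : Cnum := ((Hcoef d m)%:C)%C.
pose c k : Cnum := ((scale k)^-1%:C)%C.
pose p k : {poly Cnum} := map_poly (real_complex R) ((scale k)^-1 *: h k).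
have hE k : map_poly (real_complex R) (h k) = (('X - (r k)%:P) * Q k).
  apply: eq_poly_horner => z; have := congr1 toC (roots k (ofC z)).
  rewrite toC_hpoly (cdim_bsd_iter Dc Dd) // ofCK => ->.
  rewrite toCM toCB toC_prod ofCK hornerM hornerXsubC /Q /linear_factors big_mkord horner_prod.
  by congr (_ * _); apply: eq_bigr => i _; rewrite toCB ofCK hornerXsubC.
have pE k : p k = (c k *: (('X - (r k)%:P) * Q k)) by rewrite /p map_polyZ hE.
have sQ k : size (Q k) = d.+1 by rewrite size_linear_factors subn0.
have Q1 k : (Q k)`_d = 1.
  have : Q k \is monic by rewrite /Q linear_factorsE monic_prod_XsubC.
  by rewrite monicE lead_coefE sQ => /eqP.
have Qd k : (`|(Q k)`_d.-1| <= d%:R * `|r k|).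
  move: (order k); rewrite /Q; case: (d) d1 => // n _ ord.
  by apply: coef_pred_linear_factors_le => i /ord [/Cnorm_le].
have c0 : c @ \oo --> (0 : Cnum) by exact: (cvg_real_complex (scale_cvg D d1)).
have plim m : (fun k => (p k)`_m : Cnum) @ \oo --> H m.
  under eq_fun do rewrite coef_map.
  have lim := @scaled_hpoly_cvg _ D d Dc Dd d1 m; exact (cvg_real_complex lim).
have Hd0 : H d != 0.
  by rewrite /H fmorph_eq0 Hcoef_lead // gt_eqF // Fc1_gt0.
have dS : d.-1.+1 = d by rewrite prednK.
have [rV0 r0 Qlim] : [/\ (fun k => (r k)^-1) @ \oo --> (0 : Cnum),
    \forall k \near \oo, r k != 0 &
    forall m, (m <= d)%N -> (fun k => (Q k)`_m) @ \oo --> (H m / H d)].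
  (* The lemma is stated for a quotient of degree one more than its parameter, hence [d.-1]. *)
  rewrite -dS; apply: (@quotient_by_dominant_root Cnum d.-1 p Q c r H); rewrite ?dS //.
  by move=> k; rewrite sQ.
pose Qoo : {poly Cnum} := (\poly_(i < d.+1) (H i / H d)).
have {}Qlim m : (fun k => (Q k)`_m) @ \oo --> (Qoo`_m).
  rewrite coef_poly ltnS; case: leqP => [|dm]; first exact: Qlim.
  by under eq_fun => k do [rewrite nth_default ?sQ //]; exact: cvg_cst.
(* The monic limit [Qoo] vanishes at 0 by [Hcoef0]; [Q'] is its quotient by the variable. *)
pose Q' : {poly Cnum} := (\poly_(i < d) Qoo`_i.+1).
have QooE : Qoo = (('X - 0%:P) * Q').
  apply/polyP => m; rewrite subr0 coefXM; case: m => [|m] /=.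
    by rewrite coef_poly /H Hcoef0 // mul0r.
  rewrite [in RHS]coef_poly; case: ltnP => // dm.
  by rewrite coef_poly ltnNge; case: leqP => //; lia.
have sQ' : size Q' = d.
  by apply: size_poly_eq; rewrite dS coef_poly ltnSn mulfV ?oner_neq0.
(* A root of minimal modulus is a closest root to 0, which is a zero of [Qoo]. *)
have rho0 : (fun k => toC (rho k 0%N) : Cnum) @ \oo --> (0 : Cnum).
  apply: (@closest_root_cvg Cnum d (fun k => [seq toC (rho k i) | i <- index_iota 0 d]) _ Qoo).
  - exact: d1.
  - by move=> k; rewrite size_map size_iota subn0.
  - exact: size_poly.
  - by rewrite rootE QooE hornerM hornerXsubC subrr mul0r.
  - by move=> m; under eq_fun do rewrite -linear_factorsE; exact: Qlim.
  move=> k y; case/mapP => i; rewrite mem_index_iota => /andP[_ id] ->.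
  by rewrite !sub0r !normrN; apply: Cnorm_le; case: (order k i id).
have Q'lim m : (fun k => (linear_factors (rho k) 1 d)`_m : Cnum) @ \oo --> (Q'`_m).
  apply: (@deflation_cvg Cnum d _ _ _ _ _ _ rho0) => [k||j].
  - by rewrite size_linear_factors subn1 dS.
  - by rewrite sQ'.
  rewrite -QooE; have := Qlim j; rewrite /Q /linear_factors.
  by under eq_fun do rewrite big_ltn //.
split; first exact: Un_cv_Cnorm.
split.
  have [sigma [s1 s2 s3]] := labelled_roots_cvg d1 sQ' Q'lim.
  exists sigma; do 2!split=> //; move=> i /s3 [L iL]; exists L; exact: Ccv_toC.
split.
  (* The conjugate of [r k] also escapes to infinity, so eventually it is not a root of [Q k]; a
     nonreal [r k] would contradict this. *)
  have : \forall k \near \oo, ((Q k).[(r k)^*%C] != 0).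
    apply: (@nonvanishing_at_infinity Cnum d Q (fun m => Qoo`_m)).
    - by move=> k; rewrite sQ.
    - by move=> m _; exact: Qlim.
    - by rewrite coef_poly ltnSn mulfV ?oner_neq0.
    - by apply: filterS r0 => k; rewrite conjc_eq0.
    apply: (cvgn0_le ltr01 rV0); near=> k.
    by rewrite mul1r -conjc_inv normcJ.
  case=> N _ HN; exists N => k /HN nz.
  have [rr|ne] := eqVneq ((r k)^*)%C (r k); last by rewrite (nonreal_root_conj (hE k) ne) eqxx in nz.
  have /eqP := congr1 (@complex.Im R) rr; rewrite /r /=.
  by rewrite eqNr => /eqP.
split; first exact: cv_infty_Cnorm.
split=> [m|]; apply: Ccv_toC.
  under eq_fun do rewrite toCM toC_real -coef_linear_factors.
  have -> : toC (RtoC (Hcoef d m)) = (H d * Qoo`_m).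
    rewrite coef_poly ltnS; case: leqP => [_|dm]; first by rewrite mulrC divfK.
    by rewrite mulr0 toC_real Hcoef_large.
  by apply: cvgM; [exact: cvg_cst | exact: Qlim].
(* The constant coefficient of [Q'] is the ratio of the coefficients of [z] and [z^d] in [H_d],
   which is 1 by [Hcoef1]. *)
have -> : toC (RtoC (msign d.-1)) = ((-1) ^+ d.-1 * Q'`_0).
  rewrite coef_poly d1 coef_poly ltnS d1 /H Hcoef1 // mulfV // mulr1 toC_real.
  by rewrite /msign RpowE rmorphXn rmorphN1.
under eq_fun => k.
  have -> : toC (Cprod (fun i => rho k i.+1) d.-1) =
      ((-1) ^+ d.-1 * (linear_factors (rho k) 1 d)`_0).
    rewrite -horner_coef0 /linear_factors horner_prod toC_prod.
    rewrite big_add1 big_mkord -[X in (_ ^+ X)](card_ord d.-1) -prodrN.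
    by apply: eq_bigr => i _; rewrite hornerXsubC sub0r opprK.
  over.
by apply: cvgM; [exact: cvg_cst | exact: Q'lim].
Unshelve. all: by end_near. Qed.
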